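(* The following hold: 1) Free solvable groups are rigid. 2) If $A$ is a torsion-free abelian group and $B$ is a rigid group, then the wreath product $A \wr B$ is rigid.
   Context: A right module $T$ over a ring $R$ has no torsion if $xr=0$ with $x\in T$, $r\in R$ implies $x=0$ or $r=0$. A principal series of a group $G$ is a series of normal subgroups of $G$, $G = G_1 > G_2 > \cdots > G_n > G_{n+1} = 1$, such that each factor $G_i/G_{i+1}$ is abelian and has no torsion as a right $\mathbb{Z}[G/G_i]$-module (the action being induced by conjugation $x^g=g^{-1}xg$), $i=1,\ldots,n$. A group with a principal series is called rigid. A free solvable group is a group $F/F^{(n)}$, where $F$ is a free group and $F^{(n)}$ is the $n$-th term of its derived series. $A\wr B$ denotes the (restricted, discrete) wreath product, i.e. $\bigl(\bigoplus_{b\in B}A\bigr)\rtimes B$ with $B$ acting by translation of the coordinates. *)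

(* Defs.v *)
From HB Require Import structures.
From mathcomp Require Import all_boot all_order all_algebra.
From mathcomp Require Import generic_quotient finmap monalg boolp.

Set Implicit Arguments.
Unset Strict Implicit.
Unset Printing Implicit Defensive.

Import GRing.Theory.

Local Open Scope group_scope.
Local Open Scope quotient_scope.

Definition abelian_group (G : groupType) : Prop := forall x y : G, commute x y.

Definition torsion_free (G : groupType) : Prop :=
  forall (x : G) (n : nat), (0 < n)%N -> x ^+ n = 1 -> x = 1.

(* Subgroups of a groupType are boolean predicates; by mathcomp.classical.boolp
   every Prop-valued predicate is available in this form. *)
HB.mixin Record isConjClosed (G : groupType) (S : {pred G}) := {
  gpredJr : forall x y : G, x \in S -> x ^ y \in S
}.

#[short(type="normalClosed")]
HB.structure Definition NormalClosed (G : groupType) :=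
  {S of GroupClosed G S & isConjClosed G S}.

Section SubgroupType.
Variables (G : groupType) (H : groupClosed G).

Definition subgroup_type : Type := {x : G | x \in H}.

HB.instance Definition _ := SubChoice.copy subgroup_type {x : G | x \in H}.

Fact subgroup_closed : group_closed H.
Proof. by split; [exact: gpred1 | move=> x y xH yH; exact: gpredF]. Qed.

HB.instance Definition _ :=
  SubChoice_isSubGroup.Build G _ subgroup_type subgroup_closed.

End SubgroupType.

Section Quotient.
Variables (G : groupType) (N : normalClosed G).

Definition coset_eq : rel G := fun x y => x^-1 * y \in N.

Fact coset_eq_refl : reflexive coset_eq.
Proof. by move=> x; rewrite /coset_eq mulVg gpred1. Qed.

Fact coset_eq_sym : symmetric coset_eq.
Proof. by move=> x y; rewrite /coset_eq -gpredV invgM invgK. Qed.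

Fact coset_eq_trans : transitive coset_eq.
Proof.
move=> y x z; rewrite /coset_eq => xy yz.
by rewrite -(mulgK y x^-1) -mulgA gpredM.
Qed.

Canonical coset_equiv :=
  EquivRel coset_eq coset_eq_refl coset_eq_sym coset_eq_trans.

Definition quotient_group : Type := {eq_quot coset_equiv}.

HB.instance Definition _ := Choice.on quotient_group.
HB.instance Definition _ := EqQuotient.on quotient_group.

Local Notation "\piN" := (\pi_quotient_group).

Lemma piN_eqP (x y : G) : reflect (\piN x = \piN y) (x^-1 * y \in N).
Proof. exact: (eqquotP quotient_group x y). Qed.

Lemma repr_piN (x : G) : exists2 u, u \in N & repr (\piN x) = x * u.
Proof.
exists (x^-1 * repr (\piN x)); last by rewrite mulVKg.
by apply/piN_eqP; rewrite reprK.
Qed.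

Lemma quotient_ind (P : quotient_group -> Prop) :
  (forall x, P (\piN x)) -> forall a, P a.
Proof. by move=> piP a; rewrite -[a]reprK. Qed.

Definition quotient_one : quotient_group := \piN 1.
Definition quotient_mul (a b : quotient_group) : quotient_group :=
  \piN (repr a * repr b).
Definition quotient_inv (a : quotient_group) : quotient_group :=
  \piN (repr a)^-1.

Lemma quotient_mulE x y : quotient_mul (\piN x) (\piN y) = \piN (x * y).
Proof.
rewrite /quotient_mul; have [u uN ->] := repr_piN x.
have [v vN ->] := repr_piN y; apply/esym/piN_eqP.
have -> : (x * y)^-1 * (x * u * (y * v)) = u ^ y * v.
  by rewrite invgM /conjg -!mulgA mulKg.
by apply: gpredM => //; apply: gpredJr.
Qed.

Lemma quotient_invE x : quotient_inv (\piN x) = \piN x^-1.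
Proof.
rewrite /quotient_inv; have [u uN ->] := repr_piN x.
apply/esym/piN_eqP; rewrite invgK invgM.
have -> : x * (u^-1 * x^-1) = u^-1 ^ x^-1 by rewrite /conjg invgK.
by apply: gpredJr; rewrite gpredV.
Qed.

Fact quotient_mulA : associative quotient_mul.
Proof.
move=> x y z; elim/quotient_ind: x => x; elim/quotient_ind: y => y; elim/quotient_ind: z => z.
by rewrite !quotient_mulE mulgA.
Qed.

Fact quotient_mul1g : left_id quotient_one quotient_mul.
Proof. by move=> x; elim/quotient_ind: x => x; rewrite quotient_mulE mul1g. Qed.

Fact quotient_mulg1 : right_id quotient_one quotient_mul.
Proof. by move=> x; elim/quotient_ind: x => x; rewrite quotient_mulE mulg1. Qed.

Fact quotient_mulVg : left_inverse quotient_one quotient_inv quotient_mul.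
Proof. by move=> x; elim/quotient_ind: x => x; rewrite quotient_invE quotient_mulE mulVg. Qed.

Fact quotient_mulgV : right_inverse quotient_one quotient_inv quotient_mul.
Proof. by move=> x; elim/quotient_ind: x => x; rewrite quotient_invE quotient_mulE mulgV. Qed.

HB.instance Definition _ := isGroup.Build quotient_group quotient_mulA
  quotient_mul1g quotient_mulg1 quotient_mulVg quotient_mulgV.

Lemma quotient_piM (x y : G) : \piN (x * y) = \piN x * \piN y.
Proof. by rewrite -quotient_mulE. Qed.

End Quotient.

Arguments quotient_group {G} N.

Section GroupRing.
Variable Q : groupType.
Local Open Scope fset_scope.
Local Open Scope ring_scope.

(* The multiplication of {malg R[K]} provided by the library is restricted to
   monoids K without nontrivial units, hence the alias and the redefinition. *)
Definition group_ring : Type := {malg int[Q]}.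

HB.instance Definition _ := GRing.Zmodule.on group_ring.

Implicit Types (g h : group_ring) (k : Q).

Definition gr_one : group_ring := << 1%g >>.

Definition gr_mul g h : group_ring :=
  \sum_(k1 <- msupp g) \sum_(k2 <- msupp h) << g@_k1 * h@_k2 *g (k1 * k2)%g >>.

Lemma gr_mulw (d1 d2 : {fset Q}) g h :
  msupp g `<=` d1 -> msupp h `<=` d2 ->
  gr_mul g h =
    \sum_(k1 <- d1) \sum_(k2 <- d2) << g@_k1 * h@_k2 *g (k1 * k2)%g >>.
Proof.
move=> le_d1 le_d2; rewrite /gr_mul (big_fset_incl _ le_d1) /=.
  apply/eq_bigr=> k1 _; apply/big_fset_incl => // k _ /mcoeff_outdom ->.
  by rewrite mulr0 monalgU0.
move=> k _ /mcoeff_outdom gk.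
by rewrite big1 => // k' _; rewrite gk mul0r monalgU0.
Qed.

Lemma gr_mul0 g : gr_mul 0 g = 0.
Proof. by rewrite /gr_mul msupp0 big_seq_fset0. Qed.

Lemma gr_mulr0 g : gr_mul g 0 = 0.
Proof. by rewrite /gr_mul big1 // => k _; rewrite msupp0 big_seq_fset0. Qed.

Lemma gr_mulUU (c1 c2 : int) k1 k2 :
  gr_mul << c1 *g k1 >> << c2 *g k2 >> = << c1 * c2 *g (k1 * k2)%g >>.
Proof. by rewrite (gr_mulw msuppU_le msuppU_le) !big_seq_fset1 !mcoeffUU. Qed.

Fact gr_mulDl : left_distributive gr_mul +%R.
Proof.
move=> g1 g2 g.
rewrite (gr_mulw (msuppD_le g1 g2) (fsubset_refl _)).
rewrite [in RHS](gr_mulw (fsubsetUl _ (msupp g2)) (fsubset_refl _)).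
rewrite [in RHS](gr_mulw (fsubsetUr (msupp g1) _) (fsubset_refl _)).
rewrite -big_split /=; apply/eq_bigr=> k1 _.
rewrite -big_split /=; apply/eq_bigr=> k2 _.
by rewrite mcoeffD mulrDl monalgUD.
Qed.

Fact gr_mulDr : right_distributive gr_mul +%R.
Proof.
move=> g g1 g2.
rewrite (gr_mulw (fsubset_refl _) (msuppD_le g1 g2)).
rewrite [in RHS](gr_mulw (fsubset_refl _) (fsubsetUl _ (msupp g2))).
rewrite [in RHS](gr_mulw (fsubset_refl _) (fsubsetUr (msupp g1) _)).
rewrite -big_split /=; apply/eq_bigr=> k1 _.
rewrite -big_split /=; apply/eq_bigr=> k2 _.
by rewrite mcoeffD mulrDr monalgUD.
Qed.

Lemma gr_ind (P : group_ring -> Prop) :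
  P 0 -> (forall g h, P g -> P h -> P (g + h)) ->
  (forall (c : int) k, P << c *g k >>) -> forall g, P g.
Proof. by move=> P0 PD PU g; rewrite [g]monalgE; apply: big_ind. Qed.

Fact gr_mulA : associative gr_mul.
Proof.
elim/gr_ind=> [g2 g3|g h IHg IHh g2 g3|c1 k1]; first by rewrite !gr_mul0.
  by rewrite !gr_mulDl IHg IHh.
elim/gr_ind=> [g3|g h IHg IHh g3|c2 k2]; first by rewrite !(gr_mulr0, gr_mul0).
  by rewrite !(gr_mulDl, gr_mulDr) IHg IHh.
elim/gr_ind=> [|g h IHg IHh|c3 k3]; first by rewrite !gr_mulr0.
  by rewrite !gr_mulDr IHg IHh.
by rewrite !gr_mulUU mulrA mulgA.
Qed.

Fact gr_mul1 : left_id gr_one gr_mul.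
Proof.
elim/gr_ind=> [|g h IHg IHh|c k]; first by rewrite gr_mulr0.
  by rewrite gr_mulDr IHg IHh.
by rewrite gr_mulUU mul1r mul1g.
Qed.

Fact gr_mulr1 : right_id gr_one gr_mul.
Proof.
elim/gr_ind=> [|g h IHg IHh|c k]; first by rewrite gr_mul0.
  by rewrite gr_mulDl IHg IHh.
by rewrite gr_mulUU mulr1 mulg1.
Qed.

Fact gr_one_neq0 : gr_one != 0.
Proof. by apply/eqP/malgP=> /(_ 1%g) /eqP; rewrite !mcoeffsE oner_eq0. Qed.

HB.instance Definition _ := GRing.Zmodule_isNzRing.Build group_ring
  gr_mulA gr_mul1 gr_mulr1 gr_mulDl gr_mulDr gr_one_neq0.

End GroupRing.

(* A right R-module is a left module over the converse ring R^c, so that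
   "x r" is written r *: x. *)
Notation rmodType R := (lmodType R^c).

Definition no_torsion (R : nzRingType) (T : rmodType R) : Prop :=
  forall (x : T) (r : R^c), (r *: x = 0 -> x = 0 \/ r = 0)%R.

Record right_action (Q : groupType) (T : zmodType) := RightAction {
  ract :> T -> Q -> T;
  ractD : forall k, {morph ract^~ k : x y / (x + y)%R};
  ract1 : forall x, ract x 1 = x;
  ractM : forall x k l, ract x (k * l) = ract (ract x k) l
}.

Section GroupRingModule.
Variables (Q : groupType) (T : zmodType) (a : right_action Q T).
Local Open Scope fset_scope.
Local Open Scope ring_scope.

Definition group_module of right_action Q T : Type := T.
Local Notation M := (group_module a).

HB.instance Definition _ := GRing.Zmodule.on M.

Definition gm_scale (r : (group_ring Q)^c) (x : M) : M :=
  \sum_(k <- msupp r) a x k *~ r@_k.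

Lemma ract0 k : a 0 k = 0.
Proof. by apply: (addrI (a 0 k)); rewrite -ractD !addr0. Qed.

Lemma ractN k x : a (- x) k = - a x k.
Proof. by apply: (addrI (a x k)); rewrite -ractD !subrr ract0. Qed.

Lemma ractMz k x (n : int) : a (x *~ n) k = a x k *~ n.
Proof.
have actMn m : a (x *+ m) k = a x k *+ m.
  by elim: m => [|m IHm]; rewrite ?mulr0n ?ract0 // !mulrS ractD IHm.
by case: n => n; rewrite ?NegzE ?mulrNz -?pmulrn ?ractN actMn.
Qed.

Lemma gm_scalew (d : {fset Q}) (r : group_ring Q) (x : M) : msupp r `<=` d ->
  gm_scale r x = \sum_(k <- d) a x k *~ r@_k.
Proof.
move=> le_d; rewrite /gm_scale (big_fset_incl _ le_d) //= => k _.
by move=> /mcoeff_outdom ->; rewrite mulr0z.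
Qed.

Lemma gm_scaleU (c : int) (k : Q) (x : M) :
  gm_scale (<< c *g k >> : group_ring Q) x = a x k *~ c.
Proof. by rewrite (gm_scalew _ msuppU_le) big_seq_fset1 mcoeffUU. Qed.

Lemma gm_scale0 (x : M) : gm_scale (0 : group_ring Q) x = 0.
Proof. by rewrite /gm_scale msupp0 big_seq_fset0. Qed.

Fact gm_scaleDl (x : M) : {morph gm_scale^~ x : r s / r + s}.
Proof.
move=> r s /=; rewrite (gm_scalew _ (msuppD_le r s)).
rewrite (gm_scalew _ (fsubsetUl (msupp r) (msupp s))).
rewrite (gm_scalew _ (fsubsetUr (msupp r) (msupp s))) -big_split /=.
by apply: eq_bigr => k _; rewrite mcoeffD mulrzDr.
Qed.

Fact gm_scaleDr : right_distributive gm_scale +%R.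
Proof.
move=> r x y; rewrite /gm_scale -big_split /=.
by apply: eq_bigr => k _; rewrite ractD mulrzDl.
Qed.

Lemma gm_scaler0 r : gm_scale r 0 = 0.
Proof. by apply: (addrI (gm_scale r 0)); rewrite -gm_scaleDr !addr0. Qed.

Fact gm_scale1 : left_id 1 gm_scale.
Proof. by move=> x; rewrite [LHS]gm_scaleU ract1. Qed.

Fact gm_scaleA (r s : (group_ring Q)^c) (x : M) :
  gm_scale r (gm_scale s x) = gm_scale (r * s) x.
Proof.
rewrite -[r * s]/((s : group_ring Q) * (r : group_ring Q)).
elim/gr_ind: s r x => [r x|g h IHg IHh r x|c k].
- by rewrite mul0r !gm_scale0 gm_scaler0.
- by rewrite mulrDl !gm_scaleDl gm_scaleDr IHg IHh.
elim/gr_ind=> [x|g h IHg IHh x|d l x].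
- by rewrite mulr0 !gm_scale0.
- by rewrite mulrDr !gm_scaleDl IHg IHh.
by rewrite [_ * _]gr_mulUU !gm_scaleU ractM ractMz mulrzA.
Qed.

HB.instance Definition _ := GRing.Zmodule_isLmodule.Build (group_ring Q)^c M
  gm_scaleA gm_scale1 gm_scaleDr gm_scaleDl.

End GroupRingModule.

Section AdditiveGroup.
Variables (T : groupType) (abT : abelian_group T).

Definition additive_group of abelian_group T : Type := T.

HB.instance Definition _ := Choice.on (additive_group abT).

HB.instance Definition _ := GRing.isZmodule.Build (additive_group abT)
  (@mulgA T) abT (@mul1g T) (@mulVg T).

End AdditiveGroup.

Section Factor.
Variables (G : groupType) (H K : normalClosed G).

Definition restrict : {pred subgroup_type H} := fun x => \val x \in K.

Lemma in_restrict x : (x \in restrict) = (\val x \in K).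
Proof. by []. Qed.

Fact restrict_mul : mulg_closed restrict.
Proof. by move=> x y; rewrite !in_restrict valM; apply: gpredM. Qed.
Fact restrict_one : 1 \in restrict.
Proof. by rewrite in_restrict val1 gpred1. Qed.
Lemma restrict_val_inv (x : subgroup_type H) : \val x^-1 = (\val x)^-1.
Proof. by apply: (mulgI (\val x)); rewrite -valM !mulgV val1. Qed.
Fact restrict_inv : invg_closed restrict.
Proof. by move=> x; rewrite !in_restrict restrict_val_inv gpredV. Qed.
Fact restrict_conj (x y : subgroup_type H) :
  x \in restrict -> x ^ y \in restrict.
Proof.
by rewrite !in_restrict /conjg !valM restrict_val_inv; apply: gpredJr. Qed.

HB.instance Definition _ := isMulClosed.Build _ restrict restrict_mul.
HB.instance Definition _ := isMul1Closed.Build _ restrict restrict_one.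
HB.instance Definition _ := isInvClosed.Build _ restrict restrict_inv.
HB.instance Definition _ := isConjClosed.Build _ restrict restrict_conj.

(* This is H / (H :&: K), that is H / K when K is contained in H. *)
Definition factor : groupType := quotient_group restrict.

Definition sub_conj (x : subgroup_type H) (g : G) : subgroup_type H :=
  exist _ (\val x ^ g) (gpredJr _ g (valP x)).

Definition factor_act (x : factor) (g : quotient_group H) : factor :=
  \pi_factor (sub_conj (repr x) (repr g)).

Hypothesis abHK : abelian_group factor.

Lemma factor_actE (x : subgroup_type H) (g : G) :
  factor_act (\pi_factor x) (\pi_(quotient_group H) g)
    = \pi_factor (sub_conj x g).
Proof.
rewrite /factor_act; have [u uK ->] := repr_piN restrict x.
have [h hH ->] := repr_piN H g.
pose h' : subgroup_type H := exist _ h hH.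
have -> : sub_conj (x * u) (g * h) = sub_conj x g ^ h' * sub_conj u (g * h).
  apply: val_inj; rewrite /= /conjg.
  by rewrite !invgM -!mulgA !(mulKg, mulVKg).
rewrite quotient_piM -[RHS]mulg1; congr (_ * _).
  rewrite /conjg !quotient_piM.
  rewrite [X in _ * X](abHK (\pi_factor (sub_conj x g))) mulgA.
  by rewrite -(quotient_piM _ h'^-1) mulVg [X in X * _]/(1 : factor) mul1g.
by apply/esym/piN_eqP; rewrite invg1 mul1g in_restrict /=; apply: gpredJr.
Qed.

Fact factor_actD (k : quotient_group H) :
  {morph factor_act^~ k : x y / ((x : additive_group abHK) + y)%R}.
Proof.
elim/quotient_ind: k => g a b.
elim/quotient_ind: a => x; elim/quotient_ind: b => y.
rewrite -[(_ + _)%R]quotient_piM -[RHS]/(_ * _).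
rewrite !factor_actE -quotient_piM; congr (\pi_factor _).
apply: val_inj; rewrite /= /conjg.
by rewrite -!mulgA !(mulKg, mulVKg).
Qed.

Fact factor_act1 a : factor_act a 1 = a.
Proof.
elim/quotient_ind: a => x; rewrite factor_actE; congr (\pi_factor _).
by apply: val_inj; rewrite /= /conjg invg1 mul1g mulg1.
Qed.

Fact factor_actM a (k l : quotient_group H) :
  factor_act a (k * l) = factor_act (factor_act a k) l.
Proof.
elim/(@quotient_ind _ H): k => g; elim/(@quotient_ind _ H): l => h.
elim/quotient_ind: a => x.
rewrite -quotient_piM !(factor_actE x) factor_actE; congr (\pi_factor _).
by apply: val_inj; rewrite /= conjgM.
Qed.

Definition factor_action : right_action (quotient_group H) (additive_group abHK)
  := @RightAction (quotient_group H) (additive_group abHK) factor_act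
       factor_actD factor_act1 factor_actM.

Definition factor_module : rmodType (group_ring (quotient_group H)) :=
  group_module factor_action.

Lemma factor_moduleE (x : subgroup_type H) (g : G) :
  (((<< \pi_(quotient_group H) g >> : group_ring (quotient_group H))
      : (group_ring (quotient_group H))^c)
     *: (\pi_factor x : factor_module))%R = \pi_factor (sub_conj x g).
Proof.
by rewrite -factor_actE; apply: (@gm_scaleU _ _ factor_action 1%R).
Qed.

End Factor.

(* The terms s 1, ..., s n.+1 form the series; the other values of s are
   irrelevant. For n = 0 the group is trivial. *)
Definition principal_series (G : groupType) (n : nat)
    (s : nat -> normalClosed G) : Prop :=
  [/\ forall x : G, x \in s 1%N,
      forall x : G, x \in s n.+1 -> x = 1
    & forall i : nat, (1 <= i <= n)%N ->
      [/\ {subset s i.+1 <= s i},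
          exists2 x : G, x \in s i & x \notin s i.+1
        & exists abF : abelian_group (factor (s i) (s i.+1)),
            no_torsion (factor_module abF)]].

Definition rigid (G : groupType) : Prop :=
  exists (n : nat) (s : nat -> normalClosed G), principal_series n s.

Section DerivedSeries.
Variable G : groupType.

Definition generated (A : G -> Prop) : {pred G} := fun x : G =>
  `[< forall H : groupClosed G, (forall a, A a -> a \in H) -> x \in H >].

Fixpoint derived (n : nat) : {pred G} :=
  if n is m.+1 then
    generated (fun z => exists x y : G,
      [/\ x \in derived m, y \in derived m & z = [~ x, y]])
  else predT.

Lemma generatedP (A : G -> Prop) x :
  reflect (forall H : groupClosed G, (forall a, A a -> a \in H) -> x \in H)
    (x \in generated A).
Proof. exact: asboolP. Qed.

Fact generated_mul A : mulg_closed (generated A).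
Proof.
move=> x y /generatedP xA /generatedP yA; apply/generatedP => H AH.
by rewrite gpredM ?xA ?yA.
Qed.

Fact generated_one A : 1 \in generated A.
Proof. by apply/generatedP => H _; apply: gpred1. Qed.

Fact generated_inv A : invg_closed (generated A).
Proof. by move=> x /generatedP xA; apply/generatedP => H AH; rewrite gpredV xA. Qed.

HB.instance Definition _ A := isMulClosed.Build G (generated A) (@generated_mul A).
HB.instance Definition _ A := isMul1Closed.Build G (generated A) (generated_one A).
HB.instance Definition _ A := isInvClosed.Build G (generated A) (@generated_inv A).

Section ConjPreimage.
Variables (H : groupClosed G) (g : G).
Definition conj_preim : {pred G} := fun x => x ^ g \in H.
Lemma in_conj_preim x : (x \in conj_preim) = (x ^ g \in H).
Proof. by []. Qed.
Fact conj_preim_mul : mulg_closed conj_preim.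
Proof.
by move=> x y; rewrite !in_conj_preim => xH yH; rewrite conjMg gpredM.
Qed.
Fact conj_preim_one : 1 \in conj_preim.
Proof. by rewrite in_conj_preim conj1g gpred1. Qed.
Fact conj_preim_inv : invg_closed conj_preim.
Proof. by move=> x; rewrite !in_conj_preim conjVg gpredV. Qed.
HB.instance Definition _ := isMulClosed.Build G conj_preim conj_preim_mul.
HB.instance Definition _ := isMul1Closed.Build G conj_preim conj_preim_one.
HB.instance Definition _ := isInvClosed.Build G conj_preim conj_preim_inv.
End ConjPreimage.

Lemma generated_conj (A : G -> Prop) :
  (forall a g, A a -> A (a ^ g)) ->
  forall x g, x \in generated A -> x ^ g \in generated A.
Proof.
move=> AJ x g /generatedP xA; apply/generatedP => H AH.
by rewrite -in_conj_preim; apply: xA => a Aa; rewrite in_conj_preim; apply/AH/AJ.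
Qed.

Fact derived_mul n : mulg_closed (derived n).
Proof. by case: n => [|n] //=; apply: generated_mul. Qed.

Fact derived_one n : 1 \in derived n.
Proof. by case: n => [|n] //=; apply: generated_one. Qed.

Fact derived_inv n : invg_closed (derived n).
Proof. by case: n => [|n] //=; apply: generated_inv. Qed.

Fact derived_conj n (x y : G) : x \in derived n -> x ^ y \in derived n.
Proof.
elim: n x y => [|n IHn] x y //; apply: generated_conj => _ g [u [v [un vn ->]]].
by exists (u ^ g), (v ^ g); rewrite conjRg !IHn.
Qed.

HB.instance Definition _ n := isMulClosed.Build G (derived n) (@derived_mul n).
HB.instance Definition _ n := isMul1Closed.Build G (derived n) (derived_one n).
HB.instance Definition _ n := isInvClosed.Build G (derived n) (@derived_inv n).
HB.instance Definition _ n := isConjClosed.Build G (derived n) (@derived_conj n).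

End DerivedSeries.

Arguments derived G n : clear implicits.

Definition free_basis (F : groupType) (X : Type) (b : X -> F) : Prop :=
  forall (H : groupType) (f : X -> H),
    exists2 phi : {multiplicative F -> H}, (forall x, phi (b x) = f x)
      & forall psi : {multiplicative F -> H},
          (forall x, psi (b x) = f x) -> psi =1 phi.

Definition free_group (F : groupType) : Prop :=
  exists (X : Type) (b : X -> F), free_basis b.

Section Wreath.
Variables A B : groupType.
Local Open Scope fset_scope.

Local Notation base := {fsfun B -> A with 1}.
Implicit Types (f g : base) (b c : B).

Definition base_mul f g : base :=
  [fsfun x in finsupp f `|` finsupp g => f x * g x].
Definition base_inv f : base := [fsfun x in finsupp f => (f x)^-1].
Definition translate b f : base :=
  [fsfun x in [fset b * y | y in finsupp f] => f (b^-1 * x)].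

Lemma base_mulE f g x : base_mul f g x = f x * g x.
Proof.
rewrite fsfun_fun in_fsetU.
by case: (finsuppP f x); case: (finsuppP g x) => //=; rewrite mulg1.
Qed.

Lemma base_invE f x : base_inv f x = (f x)^-1.
Proof. by rewrite fsfun_fun; case: finsuppP; rewrite ?invg1. Qed.

Lemma translateE b f x : translate b f x = f (b^-1 * x).
Proof.
rewrite fsfun_fun; case: imfsetP => // xNf.
have [//|fx] := finsuppP f (b^-1 * x); case: xNf.
by exists (b^-1 * x); rewrite ?mulVKg.
Qed.

(* (f, b) stands for the product f b in the semidirect product, in which b acts
   on the coordinates by left translation. *)
Definition wreath : Type := (base * B)%type.

HB.instance Definition _ := Choice.on wreath.

Definition wreath_one : wreath := ([fsfun], 1).
Definition wreath_mul (u v : wreath) : wreath :=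
  (base_mul u.1 (translate u.2 v.1), u.2 * v.2).
Definition wreath_inv (u : wreath) : wreath :=
  (translate u.2^-1 (base_inv u.1), u.2^-1).

Lemma wreath_eq (u v : wreath) : u.1 =1 v.1 -> u.2 = v.2 -> u = v.
Proof. by case: u v => [f b] [g c] /= /fsfunP -> ->. Qed.

Fact wreath_mulA : associative wreath_mul.
Proof.
move=> u v w; apply: wreath_eq => [x|] /=; last exact: mulgA.
by rewrite !(base_mulE, translateE) invgM !mulgA.
Qed.

Fact wreath_mul1g : left_id wreath_one wreath_mul.
Proof.
move=> u; apply: wreath_eq => [x|] /=; last exact: mul1g.
by rewrite base_mulE translateE fsfun0E invg1 !mul1g.
Qed.

Fact wreath_mulg1 : right_id wreath_one wreath_mul.
Proof.
move=> u; apply: wreath_eq => [x|] /=; last exact: mulg1.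
by rewrite base_mulE translateE fsfun0E mulg1.
Qed.

Fact wreath_mulVg : left_inverse wreath_one wreath_inv wreath_mul.
Proof.
move=> u; apply: wreath_eq => [x|] /=; last exact: mulVg.
by rewrite base_mulE !translateE base_invE fsfun0E mulVg.
Qed.

Fact wreath_mulgV : right_inverse wreath_one wreath_inv wreath_mul.
Proof.
move=> u; apply: wreath_eq => [x|] /=; last exact: mulgV.
by rewrite base_mulE !translateE base_invE fsfun0E invgK mulVKg mulgV.
Qed.

HB.instance Definition _ := isGroup.Build wreath wreath_mulA
  wreath_mul1g wreath_mulg1 wreath_mulVg wreath_mulgV.

End Wreath.

(* Main.v *)
Require Import Defs.
From HB Require Import structures.
From mathcomp Require Import all_boot all_algebra.
From mathcomp Require Import generic_quotient finmap monalg boolp.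
From mathcomp Require Import classical_sets.

(* A group with a principal series is left-orderable, because torsion-free
   abelian groups are and left-orderability passes to extensions. Over a
   left-orderable group B the unique product property shows that the base group
   of A wr B has no torsion over Z[B]; together with the preimage of a principal
   series of B this gives 2). Rigidity passes to subgroups: intersect the series
   and delete repeated terms. For 1), the Magnus map F -> Z^(F) wr (F/R) sends a
   basis element x to its unit vector at 1 times its coset. Its kernel is
   [R, R]: an element of R traces a loop in the Cayley graph of F/R, its image
   in R/[R, R] is determined by how often the loop runs through each edge, and
   that is what the Magnus map records. Induction on n with R = F^(n) then
   embeds F/F^(n+1) into a rigid group. *)

Set Implicit Arguments.
Unset Strict Implicit.
Unset Printing Implicit Defensive.

Import GRing.Theory Num.Theory.

Local Open Scope group_scope.
Local Open Scope quotient_scope.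

(** * Free abelian groups and left orders *)

Section FreeAbelianExtension.
Variable Y : choiceType.
Local Open Scope fset_scope.
Local Open Scope ring_scope.
Implicit Types (T : zmodType) (g h : {malg int[Y]}).

(** The additive extension of [f] to the free abelian group on [Y]; it serves both for the scalar
    action of a group ring and for evaluating Magnus coordinates. *)
Definition zlift T (f : Y -> T) g : T := \sum_(k <- msupp g) f k *~ g@_k.

Lemma zliftw T (f : Y -> T) (d : {fset Y}) g : msupp g `<=` d ->
  zlift f g = \sum_(k <- d) f k *~ g@_k.
Proof.
move=> le_d; rewrite /zlift (big_fset_incl _ le_d) //= => k _.
by move=> /mcoeff_outdom ->; rewrite mulr0z.
Qed.

Lemma zliftU T (f : Y -> T) (c : int) k : zlift f << c *g k >> = f k *~ c.
Proof. by rewrite (zliftw _ msuppU_le) big_seq_fset1 mcoeffUU. Qed.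

Lemma zlift0 T (f : Y -> T) : zlift f 0 = 0.
Proof. by rewrite /zlift msupp0 big_seq_fset0. Qed.

Lemma zliftD T (f : Y -> T) : {morph zlift f : g h / g + h}.
Proof.
move=> g h; rewrite (zliftw _ (msuppD_le g h)).
rewrite (zliftw _ (fsubsetUl (msupp g) (msupp h))).
rewrite (zliftw _ (fsubsetUr (msupp g) (msupp h))) -big_split /=.
by apply: eq_bigr => k _; rewrite mcoeffD mulrzDr.
Qed.

Lemma eq_zlift T (f f' : Y -> T) : f =1 f' -> zlift f =1 zlift f'.
Proof. by move=> ff' g; apply: eq_bigr => k _; rewrite ff'. Qed.

Lemma zlift_additive T T' (t : T -> T') (f : Y -> T) g :
  {morph t : x y / x + y} -> t (zlift f g) = zlift (t \o f) g.
Proof.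
move=> tD; have t0 : t 0 = 0 by apply: (addrI (t 0)); rewrite -tD !addr0.
have tN x : t (- x) = - t x by apply: (addrI (t x)); rewrite -tD !subrr.
have tMn x m : t (x *+ m) = t x *+ m.
  by elim: m => [|m IHm]; rewrite ?mulr0n // !mulrS tD IHm.
rewrite (big_morph t tD t0); apply: eq_bigr => k _.
by case: (g@_k) => m; rewrite ?NegzE ?mulrNz -?pmulrn ?tN tMn.
Qed.

End FreeAbelianExtension.

Section FreeAbelianMap.
Variables (Y Z : choiceType) (p : Y -> Z).
Local Open Scope ring_scope.

Definition pushforward (g : {malg int[Y]}) : {malg int[Z]} :=
  zlift (fun k => << p k >>) g.

Lemma zlift_pushforward (T : zmodType) (f : Z -> T) g :
  zlift f (pushforward g) = zlift (f \o p) g.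
Proof.
rewrite /pushforward (zlift_additive _ _ (zliftD f)).
by apply: eq_zlift => k /=; rewrite zliftU.
Qed.

(** By injectivity only [k] contributes to the coefficient at [p k]. *)
Lemma pushforward_inj_eq0 g : injective p -> pushforward g = 0 -> g = 0.
Proof.
move=> p_inj g0; apply/malgP => k; rewrite mcoeff0.
have := congr1 (mcoeff (p k)) g0; rewrite mcoeff0.
rewrite /pushforward (zlift_additive _ _ (@mcoeffD _ _ (p k))).
case: (boolP (k \in msupp g)) => [kg|/mcoeff_outdom //].
rewrite /zlift (big_fsetD1 k) //= mcoeffUU intz big_seq big1 ?addr0 // => j.
rewrite in_fsetD1 => /andP[jk _]; rewrite mcoeffU (inj_eq p_inj) (negPf jk).
by rewrite mul0rz.
Qed.

End FreeAbelianMap.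

(** * Left orders as cones, and unique products *)

Section Cones.
Variable G : groupType.
Implicit Types N P : G -> Prop.

(* [P] is the set of nonnegative elements of a left-invariant total preorder
   on [G] in which only elements of [N] are equivalent to [1]. *)
Definition is_cone N P : Prop :=
  [/\ forall x y, P x -> P y -> P (x * y), forall x, P x \/ P x^-1
    & forall x, P x -> P x^-1 -> N x].

Definition left_orderable : Prop := exists P, is_cone (eq^~ 1) P.

Lemma is_cone1 N P : is_cone N P -> P 1.
Proof. by case=> _ /(_ 1) tot _; case: tot; rewrite ?invg1. Qed.

Lemma max_seq (P : G -> Prop) (I : eqType) (f : I -> G) (s : seq I) :
  is_cone (eq^~ 1) P -> s != [::] ->
  exists2 i, i \in s & forall j, j \in s -> P ((f j)^-1 * f i).
Proof.
move=> coneP; have P1 := is_cone1 coneP; have [PM Ptot _] := coneP.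
elim: s => // i s IHs _; case: (eqVneq s [::]) => [->|/IHs[j js jmax]].
  by exists i => [|k]; rewrite !inE // => /eqP->; rewrite mulVg.
have [ij|ji] := Ptot ((f i)^-1 * f j).
  exists j => [|k]; rewrite inE ?js ?orbT // => /orP[/eqP->//|]; exact: jmax.
exists i => [|k]; rewrite inE ?eqxx // => /orP[/eqP->|]; first by rewrite mulVg.
move=> /jmax kj; rewrite invgM invgK in ji.
by rewrite -[f i](mulVKg (f j)) mulgA; apply: PM.
Qed.

(* Take [j] with [h j] largest, then [i] with [f i * h j] largest: every other
   product is strictly smaller. *)
Lemma unique_product (I J : eqType) (f : I -> G) (h : J -> G)
    (s : seq I) (t : seq J) :
  left_orderable -> injective f -> injective h -> s != [::] -> t != [::] ->
  exists2 i, i \in s & exists2 j, j \in t &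
    forall i' j', i' \in s -> j' \in t -> f i' * h j' = f i * h j ->
      i' = i /\ j' = j.
Proof.
case=> P coneP f_inj h_inj s0 t0; have [PM _ PI] := coneP.
have [j jt jmax] := max_seq h coneP t0.
have [i iS imax] := max_seq (fun i => f i * h j) coneP s0.
exists i => //; exists j => // i' j' i's j't E.
(* Write [a <= b] for [P (a^-1 * b)]. By [E] and the choice of [i], [f i' * h j <= f i' * h j'], so
   [h j <= h j']; the choice of [j] gives the converse. *)
have jj : j' = j.
  apply: h_inj; apply: (mulgI (h j')^-1); rewrite mulVg; apply/esym/PI => //.
    exact: jmax.
  have := imax _ i's; rewrite -E !invgM -!mulgA mulKg.
  by rewrite invgK.
split=> //; apply: f_inj; apply: (mulIg (h j)).
by rewrite -E jj.
Qed.

(* The lexicographic extension of an order on the quotient by an order on the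
   subgroup. *)
Lemma lex_cone (H : normalClosed G) (K C P : G -> Prop) :
  is_cone (fun x => x \in H) P -> (forall x, x \in H -> P x) ->
  (forall x y, x \in H -> y \in H -> C x -> C y -> C (x * y)) ->
  (forall x, x \in H -> C x \/ C x^-1) ->
  (forall x, x \in H -> C x -> C x^-1 -> K x) ->
  (forall x, K x -> x \in H /\ C x) ->
  exists P', is_cone K P' /\ (forall x, K x -> P' x).
Proof.
case=> PM Ptot PI HP CM Ctot CI KC.
exists (fun x => P x /\ (x \in H -> C x)); split; last first.
  by move=> x /KC[xH Cx]; split=> //; apply: HP.
split=> [x y [Px Cx] [Py Cy]|x|x [Px Cx] [Px' Cx']].
- split=> [|xyH]; first exact: PM.
  (* A product of nonnegative elements lies in [H] only if both factors do, so [C] is multiplied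
     inside [H] only. *)
  have yH : y \in H.
    apply: PI => //; have -> : y^-1 = (x * y)^-1 * x by rewrite invgM mulgVK.
    by apply: PM => //; apply: HP; rewrite gpredV.
  have xH : x \in H by rewrite -[x](mulgK y) gpredM ?gpredV.
  by apply: CM; auto.
- case: (boolP (x \in H)) => xH.
    have [Cx|Cx] := Ctot _ xH; [left|right]; split=> //; apply: HP => //.
    by rewrite gpredV.
  by have [Px|Px] := Ptot x; [left|right]; split=> //;
    rewrite ?gpredV (negPf xH).
- have xH : x \in H by apply: PI.
  by apply: CI => //; [apply: Cx|apply: Cx'; rewrite gpredV].
Qed.

End Cones.

(** * Left orders on torsion-free abelian groups *)

Section TorsionFreeAbelian.
Variable T : groupType.
Hypotheses (abT : abelian_group T) (tfT : torsion_free T).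
Local Open Scope classical_set_scope.

Let partial_cone (S : set T) : Prop :=
  (forall x y, S x -> S y -> S (x * y)) /\ (forall x, S x -> S x^-1 -> x = 1).

(** Otherwise the elements [p * x ^+ n] with [p] in [S] form a strictly larger partial cone: if
    [p * x ^+ n] and [q * x ^+ m] are mutually inverse, then [x ^- (n + m) = p * q] lies in [S],
    which forces [n = m = 0]. *)
Let partial_cone_extend (S : set T) x :
  partial_cone S -> S 1 -> ~ S x -> (forall B, S `<` B -> ~ partial_cone B) ->
  exists2 n, (0 < n)%N & S (x ^- n).
Proof.
move=> [SM SI] S1 Sx Smax; apply: contrapT => noneg.
pose S' : set T := fun y => exists2 p, S p & exists n, y = p * x ^+ n.
apply: (Smax S').
  split=> [|sub]; last by apply/Sx/sub; exists 1 => //; exists 1%N;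
    rewrite mul1g.
  by move=> p Sp; exists p => //; exists 0%N; rewrite mulg1.
split=> [_ _ [p Sp [n ->]] [q Sq [m ->]]|y [p Sp [n yE]] [q Sq [m yV]]].
  exists (p * q); first exact: SM.
  exists (n + m)%N; rewrite expgnDr !mulgA; congr (_ * _).
  by rewrite -!mulgA; congr (_ * _); apply: abT.
have pq : x ^- (n + m) = p * q.
  apply/esym/(mulIg (x ^+ (n + m))); rewrite mulVg expgnDr -(mulVg y) yV yE.
  rewrite [RHS]abT !mulgA; congr (_ * _).
  by rewrite -!mulgA; congr (_ * _); apply: abT.
case: (posnP (n + m)%N) => [nm0|nm].
  move: nm0 => /eqP; rewrite addn_eq0 => /andP[/eqP n0 /eqP m0].
  by move: yE yV; rewrite n0 m0 !mulg1 => yp yq; apply: SI; rewrite ?yq ?yp.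
by case: noneg; exists (n + m)%N => //; rewrite pq; apply: SM.
Qed.

(** A maximal partial cone is total: if it omits [x] and [x^-1], it contains some [x ^- n] and
    [x ^+ m] with [n] and [m] positive, hence [x ^+ (n * m)] and its inverse, and torsion-freeness
    gives [x = 1]. *)
Lemma torsion_free_abelian_left_orderable : left_orderable T.
Proof.
have [|S [[SM SI] Smax]] := @Zorn_bigcup T partial_cone.
  move=> F Fcone Ftot; split=> [x y [A FA Ax] [B FB By]|x [A FA Ax] [B FB Bx]].
    have [AB|BA] := Ftot _ _ FA FB.
      by exists B => //; apply: (Fcone _ FB).1 => //; apply: AB.
    by exists A => //; apply: (Fcone _ FA).1 => //; apply: BA.
  have [AB|BA] := Ftot _ _ FA FB.
    by apply: (Fcone _ FB).2 => //; apply: AB.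
  by apply: (Fcone _ FA).2 => //; apply: BA.
(* The empty chain has empty union, so [partial_cone] cannot demand [1]; maximality supplies it. *)
have S1 : S 1.
  apply: contrapT => nS1; apply: (Smax (S `|` [set 1])).
    split=> [x Sx|]; first by left.
    by move=> sub; apply/nS1/sub; right.
  split=> [x y [Sx|->] [Sy|->]|x [Sx|->//] [Sx'|]].
  - by left; apply: SM.
  - by rewrite mulg1; left.
  - by rewrite mul1g; left.
  - by rewrite mul1g; right.
  - exact: SI.
  - by move=> x1; rewrite -[x]invgK x1 invg1.
have SX x n : S x -> S (x ^+ n).
  by move=> Sx; elim: n => [|n IHn] //; rewrite expgS; apply: SM.
exists S; split=> // x; apply: contrapT => /not_orP[nx nx'].
have S' : partial_cone S by split.
have [n n0 Sn] := partial_cone_extend S' S1 nx Smax.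
have [m m0 Sm] := partial_cone_extend S' S1 nx' Smax.
apply: nx; rewrite (_ : x = 1) //; apply: (tfT (n := (n * m)%N)).
  by rewrite muln_gt0 n0.
apply: SI.
  by rewrite mulnC expgnA; apply: SX; rewrite -expVgn invgK in Sm.
by rewrite expgnA -expVgn; apply: SX.
Qed.

End TorsionFreeAbelian.

(** * Transport of torsion-free factors *)

Section GroupMorphisms.
Variables (G G' : groupType) (f : {multiplicative G -> G'}).

Lemma gmorph1 : f 1 = 1.
Proof. by apply: (mulgI (f 1)); rewrite -gmulfM !mulg1. Qed.

Lemma gmorphV : {morph f : x / x^-1}.
Proof. by move=> x; apply: (mulgI (f x)); rewrite -gmulfM !mulgV gmorph1. Qed.

Lemma gmorphJ : {morph f : x y / x ^ y}.
Proof. by move=> x y; rewrite /conjg !gmulfM gmorphV. Qed.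

End GroupMorphisms.

Lemma gm_scaleE (Q : groupType) (T : zmodType) (a : right_action Q T)
    (r : (group_ring Q)^c) (x : group_module a) :
  (r *: x)%R = zlift (a x) (r : {malg int[Q]}).
Proof. by []. Qed.

(** If [r] kills [x], then [pushforward p r] kills [t x]; both [t] and [pushforward p] have trivial
    kernel. *)
Lemma no_torsion_transport (Q Q' : groupType) (T T' : zmodType)
    (a : right_action Q T) (a' : right_action Q' T') (p : Q -> Q') (t : T ->
      T') :
  injective p -> {morph t : x y / (x + y)%R} ->
  (forall x, t x = 0%R -> x = 0%R) ->
  (forall x k, t (a x k) = a' (t x) (p k)) ->
  no_torsion (group_module a') -> no_torsion (group_module a).
Proof.
move=> p_inj tD t0 ta nt x r rx.
have [|tx0|pr0] := nt (t x) (pushforward p r); last 2 first.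
- by left; apply: t0.
- by right; apply: pushforward_inj_eq0 pr0.
rewrite gm_scaleE zlift_pushforward (eq_zlift (f' := t \o a x)); last first.
  by move=> k /=; rewrite ta.
rewrite -zlift_additive // -[zlift _ _]/(r *: x)%R rx.
by apply: (addrI (t 0%R)); rewrite -tD !addr0.
Qed.

Section QuotientMap.
Variables (G G' : groupType) (N : normalClosed G) (N' : normalClosed G').
Variable f : {multiplicative G -> G'}.
Hypothesis fN : forall x, (x \in N) = (f x \in N').

Definition quotient_map (a : quotient_group N) : quotient_group N' :=
  \pi_(quotient_group N') (f (repr a)).

Lemma quotient_mapE x :
  quotient_map (\pi_(quotient_group N) x) = \pi_(quotient_group N') (f x).
Proof.
rewrite /quotient_map; have [u uN ->] := repr_piN N x.
apply/esym/piN_eqP; rewrite gmulfM mulKg.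
by rewrite -fN.
Qed.

Lemma quotient_mapM : {morph quotient_map : a b / a * b}.
Proof.
move=> a b; elim/quotient_ind: a => x; elim/quotient_ind: b => y.
by rewrite -quotient_piM !quotient_mapE gmulfM quotient_piM.
Qed.

Lemma quotient_map_inj : injective quotient_map.
Proof.
move=> a b; elim/quotient_ind: a => x; elim/quotient_ind: b => y.
rewrite !quotient_mapE => /piN_eqP xy; apply/piN_eqP.
by rewrite fN gmulfM gmorphV.
Qed.

End QuotientMap.

Definition torsionless_factor (G : groupType) (H K : normalClosed G) : Prop :=
  exists abF : abelian_group (factor H K), no_torsion (factor_module abF).

Section FactorTransport.
Variables (G G' : groupType) (f : {multiplicative G -> G'}).
Variables (H K : normalClosed G) (H' K' : normalClosed G').
Hypothesis fH : forall x, (x \in H) = (f x \in H').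
Hypothesis fK : forall x, (x \in K) = (f x \in K').

Definition sub_map (x : subgroup_type H) : subgroup_type H' :=
  exist _ (f (\val x)) (etrans (esym (fH (\val x))) (valP x)).

Fact sub_mapM : {morph sub_map : x y / x * y}.
Proof. by move=> x y; apply: val_inj; rewrite /= -gmulfM. Qed.

HB.instance Definition _ := monoid.isMultiplicative.Build _ _ sub_map sub_mapM.

Let subK (x : subgroup_type H) : (x \in restrict K) = (sub_map x \in restrict
  K').
Proof. by rewrite !in_restrict fK. Qed.

Let theta : factor H K -> factor H' K' :=
  @quotient_map _ _ (@restrict G H K) (@restrict G' H' K') sub_map.

(** As [H] and [K] are full preimages, [f] induces injections on the quotients by [H] and on the
    factors, compatible with the actions. *)
Lemma torsionless_factor_transport :
  torsionless_factor H' K' -> torsionless_factor H K.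
Proof.
case=> abF' nt; have thM := quotient_mapM subK.
have th_inj := quotient_map_inj subK.
have abF : abelian_group (factor H K).
  by move=> x y; apply: th_inj; rewrite !thM; apply: abF'.
exists abF.
apply: (no_torsion_transport (a := factor_action abF) (a' := factor_action abF')
  (p := @quotient_map _ _ H H' f) (t := theta)) nt.
- exact: quotient_map_inj.
- exact: thM.
- move=> x tx0; apply: th_inj; rewrite [LHS]tx0.
  by apply: (@mulgI (factor H' K') (theta 1)); rewrite -[RHS]thM !mulg1.
move=> x k; elim/quotient_ind: x => x; elim/quotient_ind: k => g.
rewrite [factor_action _ _ _]factor_actE //.
rewrite /theta !(quotient_mapE subK) (quotient_mapE fH) [RHS]factor_actE //.
by congr (\pi_(factor _ _) _); apply: val_inj; rewrite /= gmorphJ.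
Qed.

End FactorTransport.

Lemma torsionless_factor_eq (G : groupType) (H K H' K' : normalClosed G) :
  H =i H' -> K =i K' -> torsionless_factor H K -> torsionless_factor H' K'.
Proof.
move=> HH KK.
by apply: (@torsionless_factor_transport G G idfun H' K' H K) => x;
  rewrite ?HH ?KK.
Qed.

(** The [n]-th power map is the action of the scalar [n] of the group ring, nonzero for positive
    [n]. *)
Lemma torsionless_factor_torsion_free (G : groupType) (H K : normalClosed G) :
  torsionless_factor H K -> torsion_free (factor H K).
Proof.
case=> abF nt x n n0 xn.
pose r : group_ring (quotient_group H) :=
  (<< n%:Z *g 1%g >>)%R.
have E : ((r : (group_ring (quotient_group H))^c)
    *: (x : factor_module abF) = 0)%R.
  by rewrite gm_scaleE zliftU [factor_action _ _ _]factor_act1 //.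
have [//|/eqP] := nt _ _ E.
by rewrite /r monalgU_eq0 => /eqP[n00]; rewrite n00 in n0.
Qed.

(** * Series with repetitions *)

(** Allowing repeated terms makes the notion stable under preimages. *)
Definition weak_series (G : groupType) (n : nat) (s : nat -> normalClosed G) :=
  [/\ forall x : G, x \in s 1%N,
      forall x : G, x \in s n.+1 -> x = 1
    & forall i : nat, (1 <= i <= n)%N ->
      {subset s i.+1 <= s i} /\ torsionless_factor (s i) (s i.+1)].

Lemma weak_series_rigid (G : groupType) n (s : nat -> normalClosed G) :
  weak_series n s -> rigid G.
Proof.
elim: n s => [|m IHm] s [s1 sn sf].
  by exists 0%N, s; split=> // -[].
case: (pselect (exists2 i, (1 <= i <= m.+1)%N & {subset s i <= s i.+1}));
  last first.
  move=> noeq; exists m.+1, s; split=> // i im; have [sub tl] := sf i im.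
  split=> //; apply: contrapT => nx; case: noeq; exists i => // x xi.
  by apply: contrapT => /negP xi'; apply: nx; exists x.
(* The terms [s i] and [s i.+1] coincide, and the latter is deleted. At [j = i] the new factor [s i]
   over [s i.+2] agrees with [s i.+1] over [s i.+2]. *)
move=> [i /andP[i1 im] si];
  apply: (IHm (fun j => if (j <= i)%N then s j else s j.+1)).
split=> [x|x|j /andP[j1 jm]]; first by rewrite i1.
  case: leqP => [_|mi xm]; first exact: sn.
  have E : i = m.+1 by apply/eqP; rewrite eqn_leq im.
  by subst i; apply/sn/si.
have [sub tl] := sf j.+1 (jm : (1 <= j.+1 <= m.+1)%N).
have [sub' tl'] := sf j (introT andP (conj j1 (leqW jm))).
case: (ltngtP j i) => // ji; subst j; split=> [x /sub /sub' //|].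
by apply: torsionless_factor_eq tl => // x; apply/idP/idP => [/sub'|/si].
Qed.

(** * Preimages of series, and left orders on rigid groups *)

Section Preimage.
Variables (G G' : groupType) (f : {multiplicative G -> G'}) (H : normalClosed
  G').

Definition gpreim : {pred G} := fun x => f x \in H.

Lemma in_gpreim x : (x \in gpreim) = (f x \in H).
Proof. by []. Qed.

Fact gpreim_mul : mulg_closed gpreim.
Proof. by move=> x y; rewrite !in_gpreim gmulfM; apply: gpredM. Qed.
Fact gpreim_one : 1 \in gpreim.
Proof. by rewrite in_gpreim gmorph1 gpred1. Qed.
Fact gpreim_inv : invg_closed gpreim.
Proof. by move=> x; rewrite !in_gpreim gmorphV gpredV. Qed.
Fact gpreim_conj (x y : G) : x \in gpreim -> x ^ y \in gpreim.
Proof. by rewrite !in_gpreim gmorphJ; apply: gpredJr. Qed.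

HB.instance Definition _ := isMulClosed.Build G gpreim gpreim_mul.
HB.instance Definition _ := isMul1Closed.Build G gpreim gpreim_one.
HB.instance Definition _ := isInvClosed.Build G gpreim gpreim_inv.
HB.instance Definition _ := isConjClosed.Build G gpreim gpreim_conj.

End Preimage.

Lemma torsionless_factor_gpreim (G G' : groupType) (f : {multiplicative G ->
  G'})
    (H K : normalClosed G') :
  torsionless_factor H K -> torsionless_factor (gpreim f H) (gpreim f K).
Proof. exact: (torsionless_factor_transport (f := f)). Qed.

Lemma principal_weak_series (G : groupType) n (s : nat -> normalClosed G) :
  principal_series n s -> weak_series n s.
Proof. by case=> s1 sn sf; split=> // i /sf[]. Qed.

(** Preimages of distinct terms may coincide, hence the passage through a weak series. *)
Lemma rigid_embedding (G G' : groupType) (f : {multiplicative G -> G'}) :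
  (forall x, f x = 1 -> x = 1) -> rigid G' -> rigid G.
Proof.
move=> f1 [n [s /principal_weak_series[s1 sn sf]]].
apply: (@weak_series_rigid _ n (fun i => gpreim f (s i))).
split=> [x|x /sn/f1 //|i /sf[sub tl]]; first exact: s1.
by split=> [x|]; [apply: sub | apply: torsionless_factor_gpreim].
Qed.

(** [C] is the pullback to [H] of a left order on the torsion-free abelian factor. *)
Lemma torsionless_factor_cone (G : groupType) (H K : normalClosed G) :
  {subset K <= H} -> torsionless_factor H K -> exists C : G -> Prop,
  [/\ forall x y, x \in H -> y \in H -> C x -> C y -> C (x * y),
      forall x, x \in H -> C x \/ C x^-1,
      forall x, x \in H -> C x -> C x^-1 -> x \in K
    & forall x, x \in K -> C x].
Proof.
move=> KH tl; have [abF _] := tl.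
have tf := torsionless_factor_torsion_free tl.
have [P coneP] := torsion_free_abelian_left_orderable abF tf.
have P1 := is_cone1 coneP; have [PM Ptot PI] := coneP.
pose cl x (xH : x \in H) : factor H K := \pi_(factor H K) (exist _ x xH).
have clM x y xH yH xyH : cl (x * y) xyH = cl x xH * cl y yH.
  by rewrite -quotient_piM; congr (\pi_(factor H K) _); apply: val_inj.
have cl1 x xH : cl x xH = 1 <-> x \in K.
  split=> [/esym/piN_eqP|xK]; first by rewrite invg1 mul1g.
  by apply/esym/piN_eqP; rewrite invg1 mul1g.
have clV x xH xVH : cl x^-1 xVH = (cl x xH)^-1.
  have E : x * x^-1 \in H by rewrite gpredM.
  apply: (mulgI (cl x xH)); rewrite -(clM _ _ _ _ E) [RHS]mulgV.
  by apply/cl1; rewrite mulgV gpred1.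
exists (fun x => exists xH : x \in H, P (cl x xH)).
split=> [x y xH yH [xH' Px] [yH' Py]|x xH|x xH [xH' Px] [xVH Px']|x xK].
- have xyH : x * y \in H by rewrite gpredM.
  by exists xyH; rewrite (clM _ _ xH' yH'); apply: PM.
- have xVH : x^-1 \in H by rewrite gpredV.
  have [Px|Px] := Ptot (cl x xH); [by left; exists xH|right].
  by exists xVH; rewrite (clV _ xH).
- by apply/(cl1 _ xH')/PI => //; rewrite -(clV _ _ xVH).
- by exists (KH _ xK); rewrite (_ : cl _ _ = 1) //; apply/cl1.
Qed.

(** Going down the series, a preorder with kernel [s m.+1] is refined lexicographically to one with
    kernel [s m.+2]. The start is the preorder in which all elements are equivalent. *)
Lemma rigid_left_orderable (G : groupType) : rigid G -> left_orderable G.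
Proof.
case=> n [s /principal_weak_series[s1 sn sf]].
have [P []]: exists P, is_cone (fun x : G => x \in s n.+1) P /\
                  (forall x, x \in s n.+1 -> P x); last first.
  by move=> [PM Ptot PI] _; exists P; split=> // x Px Px'; apply/sn/PI.
have: (n <= n)%N by []; elim: {1 3 4}n => [_|m IHm mn].
  by exists (fun=> True); split=> //; split=> // x; left.
have [P [coneP sP]] := IHm (ltnW mn).
have [sub tl] := sf m.+1 mn.
have [C [CM Ctot CI KC]] := torsionless_factor_cone sub tl.
by apply: (lex_cone coneP sP CM Ctot CI) => x xK; auto.
Qed.

(** * Wreath products *)

(* Coordinates of an element are indexed by [B], on which [Q] acts through
   translations; the unique product supplies a coordinate of [r *: x] which is
   a single nonzero term. *)
Lemma no_torsion_coord (Q B : groupType) (T A : zmodType)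
    (a : right_action Q T) (p : Q -> B) (ev : T -> B -> A) :
  left_orderable B -> injective p ->
  (forall b, {morph ev^~ b : x y / (x + y)%R}) ->
  (forall x, (forall b, ev x b = 0%R) -> x = 0%R) ->
  (forall x, exists s : seq B, forall b, ev x b != 0%R -> b \in s) ->
  (forall x k b, ev (a x k) b = ev x (p k * b)) ->
  (forall (y : A) (n : int), (y *~ n = 0 -> y = 0 \/ n = 0)%R) ->
  no_torsion (group_module a).
Proof.
move=> ordB p_inj evD ev0 ev_fin ev_act tfA x r rx.
have [x0|xn0] := pselect (x = 0%R); [by left|right].
apply: contrapT => rn0.
have [s0 s0P] := ev_fin x; pose s := [seq b <- s0 | ev x b != 0%R].
have sP b : (b \in s) = (ev x b != 0%R).
  by rewrite mem_filter andb_idr //; apply: s0P.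
have s_n0 : s != [::].
  apply: contra_notN xn0 => /eqP s_nil; apply: ev0 => b.
  by have := sP b; rewrite s_nil in_nil; case: eqP.
pose g : {malg int[Q]} := r; pose t : seq Q := msupp g.
have tP k : (k \in t) = (mcoeff k g != 0%R) by rewrite mcoeff_neq0.
have t_n0 : t != [::].
  apply: contra_notN rn0 => /eqP t_nil; apply/malgP => k; rewrite mcoeff0.
  by have := tP k; rewrite t_nil in_nil; case: eqP.
(* Acting by [k] moves the coordinate at [b] to [(p k)^-1 * b], so these are the products to be
   distinguished. *)
have pV_inj : injective (fun k => (p k)^-1) by move=> k l /invg_inj/p_inj.
have [k kt [b bs uniq_kb]] :=
  unique_product ordB pV_inj (@inj_id B) t_n0 s_n0.
have E := zlift_additive (a x) g (evD ((p k)^-1 * b)).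
rewrite /= [zlift _ _]rx in E.
have {}E : (ev x b *~ mcoeff k g = 0)%R.
  have ev00 : ev 0%R ((p k)^-1 * b) = 0%R.
    by apply: (addrI (ev 0%R ((p k)^-1 * b))); rewrite -evD !addr0.
  rewrite -[RHS]ev00 [RHS]E /zlift (big_fsetD1 k) //= ev_act mulVKg.
  (* A nonzero term for another [l] would express [(p k)^-1 * b] as a second product. *)
  rewrite big_seq big1 ?addr0 // => l; rewrite in_fsetD1 => /andP[lk lt].
  rewrite ev_act; case: (eqVneq (ev x (p l * ((p k)^-1 * b))) 0%R) => [->|nz].
    by rewrite mul0rz.
  rewrite -sP in nz; have [] := uniq_kb l _ lt nz; first by rewrite mulKg.
  by move=> /eqP; rewrite (negPf lk).
by have [/eqP|/eqP] := tfA _ _ E; apply/negP; rewrite -?sP -?tP.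
Qed.

Section TrivialSubgroup.
Variable G : groupType.

Definition trivial_subgroup : {pred G} := fun x => x == 1.

Lemma in_trivial_subgroup x : (x \in trivial_subgroup) = (x == 1).
Proof. by []. Qed.

Fact trivial_mul : mulg_closed trivial_subgroup.
Proof. by move=> x y /eqP-> /eqP->; rewrite in_trivial_subgroup mulg1. Qed.
Fact trivial_one : 1 \in trivial_subgroup.
Proof. by rewrite in_trivial_subgroup. Qed.
Fact trivial_inv : invg_closed trivial_subgroup.
Proof. by move=> x /eqP->; rewrite in_trivial_subgroup invg1. Qed.
Fact trivial_conj (x y : G) : x \in trivial_subgroup -> x ^ y \in
  trivial_subgroup.
Proof. by move=> /eqP->; rewrite in_trivial_subgroup conj1g. Qed.

HB.instance Definition _ := isMulClosed.Build G trivial_subgroup trivial_mul.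
HB.instance Definition _ := isMul1Closed.Build G trivial_subgroup trivial_one.
HB.instance Definition _ := isInvClosed.Build G trivial_subgroup trivial_inv.
HB.instance Definition _ := isConjClosed.Build G trivial_subgroup trivial_conj.

End TrivialSubgroup.

Section WreathRigid.
Variables A B : groupType.
Hypotheses (abA : abelian_group A) (tfA : torsion_free A).
Hypothesis rigB : rigid B.

Definition wreath_proj (u : wreath A B) : B := u.2.

Fact wreath_projM : {morph wreath_proj : u v / u * v}.
Proof. by []. Qed.

HB.instance Definition _ :=
  monoid.isMultiplicative.Build _ _ wreath_proj wreath_projM.

Section BaseFactor.
Variables H K : normalClosed (wreath A B).
Hypothesis HE : forall u : wreath A B, (u \in H) = (u.2 == 1).
Hypothesis KE : forall u : wreath A B, (u \in K) = (u == 1).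

Let ev (x : factor H K) (b : B) : A := (\val (repr x)).1 b.

Let evE (u : subgroup_type H) b : ev (\pi_(factor H K) u) b = (\val u).1 b.
Proof.
rewrite /ev; have [k kK ->] := repr_piN (restrict K) u.
rewrite in_restrict KE in kK.
by rewrite (_ : k = 1) ?mulg1 //; apply/val_inj/eqP.
Qed.

Let p (q : quotient_group H) : B := (repr q).2.

Let pE u : p (\pi_(quotient_group H) u) = u.2.
Proof.
rewrite /p; have [k kH ->] := repr_piN H u.
by rewrite HE in kH; rewrite /= (eqP kH) mulg1.
Qed.

Let sub2 (u : subgroup_type H) : (\val u).2 = 1.
Proof. by apply/eqP; rewrite -HE; apply: valP. Qed.

Let evM x y b : ev (x * y) b = ev x b * ev y b.
Proof.
elim/quotient_ind: x => u; elim/quotient_ind: y => v.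
rewrite -quotient_piM !evE /= base_mulE translateE.
by rewrite [(\val u).2]sub2 invg1 mul1g.
Qed.

Let ev_eq x y : ev x =1 ev y -> x = y.
Proof.
elim/quotient_ind: x => u; elim/quotient_ind: y => v E.
congr (\pi_(factor H K) _); apply/val_inj/wreath_eq; last by rewrite !sub2.
by move=> b; have := E b; rewrite !evE.
Qed.

(** Here [H] is the base group and [K] is trivial, so [ev] reads coordinates and [p] embeds the
    quotient by [H] into [B]. *)
Lemma base_factor_torsionless : torsionless_factor H K.
Proof.
have abF : abelian_group (factor H K).
  by move=> x y; apply: ev_eq => b; rewrite !evM abA.
have ev1 b : ev 1 b = 1 by apply: (mulgI (ev 1 b)); rewrite -evM !mulg1.
exists abF; apply: (@no_torsion_coord _ B _ (additive_group abA)
  (factor_action abF) p ev).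
- exact: rigid_left_orderable.
- move=> q q'; elim/(@quotient_ind _ H): q => u;
  elim/(@quotient_ind _ H): q' => v.
  by rewrite !pE => uv; apply/piN_eqP; rewrite HE /= uv mulVg.
- by move=> b x y; apply: evM.
- by move=> x ev0; apply: ev_eq => b; rewrite ev0 ev1.
- move=> x; exists (enum_fset (finsupp (\val (repr x)).1)) => b.
  by rewrite -[b \in _]/(b \in finsupp _) mem_finsupp.
- move=> x q b; elim/quotient_ind: x => u; elim/(@quotient_ind _ H): q => v.
  (* Conjugation by [v] shifts coordinates by [v.2] and conjugates each value inside [A], which
     changes nothing by [abA]. *)
  rewrite [factor_action _ _ _]factor_actE // pE !evE /=.
  rewrite !(base_mulE, translateE, base_invE) sub2 invg1 mul1g invgK.
  by rewrite abA mulgK.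
move=> y [n|n] yn.
  case: (posnP n) => [->|n0]; [by right|left].
  exact: tfA n0 yn.
left; apply: (tfA (n := n.+1)) => //; apply: invg_inj.
by rewrite invg1.
Qed.

End BaseFactor.

Theorem wreath_rigid : rigid (wreath A B).
Proof.
have [n [s /principal_weak_series[s1 sn sf]]] := rigB.
pose base_proj i : normalClosed (wreath A B) := gpreim wreath_proj (s i).
pose triv : normalClosed (wreath A B) := @trivial_subgroup (wreath A B).
(* The preimage of the last term [s n.+1] is the base group; one further term, the trivial subgroup,
   is appended. *)
pose s' i := if (i <= n.+1)%N then base_proj i else triv.
apply: (@weak_series_rigid _ n.+1 s'); rewrite /s'.
split=> [x|x|i /andP[i1 iN]]; first exact: s1.
  by rewrite ltnn => /eqP.
rewrite iN ltnS; case: leqP => [lt|ge].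
  have [sub tl] : {subset s i.+1 <= s i} /\ torsionless_factor (s i) (s i.+1).
    by apply: sf; rewrite i1.
  by split=> [x|]; [apply: sub | apply: torsionless_factor_gpreim].
have E : i = n.+1 by apply/eqP; rewrite eqn_leq iN.
subst i; split=> [x /eqP->|]; first exact: gpred1.
apply: base_factor_torsionless => u //.
rewrite in_gpreim; apply/idP/eqP => [/sn //|E].
by rewrite -[X in X \in _]/(u.2) E gpred1.
Qed.

End WreathRigid.

(** * The Magnus embedding *)

Section FreeBasisInd.
Variables (F : groupType) (X : Type) (b : X -> F) (P : F -> Prop).
Hypothesis freeF : free_basis b.
Hypotheses (P1 : P 1) (PM : forall x y, P x -> P y -> P (x * y)).
Hypotheses (PV : forall x, P x -> P x^-1) (Pb : forall i, P (b i)).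

Let S : {pred F} := fun x => `[< P x >].

Let S_mul : mulg_closed S.
Proof. by move=> x y /asboolP Px /asboolP Py; apply/asboolP/PM. Qed.
Let S_one : 1 \in S. Proof. exact/asboolP. Qed.
Let S_inv : invg_closed S.
Proof. by move=> x /asboolP Px; apply/asboolP/PV. Qed.

HB.instance Definition _ := isMulClosed.Build F S S_mul.
HB.instance Definition _ := isMul1Closed.Build F S S_one.
HB.instance Definition _ := isInvClosed.Build F S S_inv.

Let sub_val (x : subgroup_type S) : F := \val x.

Let sub_valM : {morph sub_val : x y / x * y}. Proof. by []. Qed.

HB.instance Definition _ := monoid.isMultiplicative.Build _ _ sub_val sub_valM.

(* Freeness gives a homomorphism from [F] to the subgroup on which [P] holds;
   composed with the inclusion it fixes the basis, so it is the identity. *)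
Lemma free_basis_ind x : P x.
Proof.
pose b' i : subgroup_type S := exist _ (b i) (asboolT (Pb i)).
have [phi phib _] := freeF b'; have [psi _ psiU] := freeF b.
have E1 := psiU idfun (fun=> erefl).
have E2 : sub_val \o phi =1 psi by apply: psiU => i /=; rewrite phib.
have -> : x = sub_val (phi x) by rewrite -[RHS]/((sub_val \o phi) x) E2 -E1.
exact: asboolW (valP (phi x)).
Qed.

End FreeBasisInd.

Section FreeAbelian.
Variable Y : choiceType.

Definition free_abelian : Type := {malg int[Y]}.

HB.instance Definition _ := Choice.on free_abelian.

HB.instance Definition _ := monoid.isGroup.Build free_abelian
  (@addrA {malg int[Y]}) (@add0r {malg int[Y]}) (@addr0 {malg int[Y]})
  (@addNr {malg int[Y]}) (@addrN {malg int[Y]}).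

Lemma free_abelian_abelian : abelian_group free_abelian.
Proof. exact: (@addrC {malg int[Y]}). Qed.

Lemma free_abelian_torsion_free : torsion_free free_abelian.
Proof.
move=> x n n0 xn; apply/malgP => k.
have : ((x : {malg int[Y]}) *+ n)%R = 0%R by exact: xn.
move/(congr1 (mcoeff k)); rewrite mcoeffMn mcoeff0 => /eqP.
by rewrite mulrn_eq0 -[n == 0%N]negbK -lt0n n0 => /eqP ->.
Qed.

End FreeAbelian.

Section Magnus.
Variables (F : groupType) (X : Type) (b : X -> F) (freeF : free_basis b).
Variables R S : normalClosed F.
Hypothesis RRS : forall x y, x \in R -> y \in R -> [~ x, y] \in S.
Hypothesis Smin : forall H : normalClosed F,
  (forall x y, x \in R -> y \in R -> [~ x, y] \in H) -> {subset S <= H}.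

Local Notation Q := (quotient_group R).
Local Notation piR := \pi_(quotient_group R).
Local Notation A := (free_abelian F).
Local Notation W := (wreath A Q).

Let abRS : abelian_group (factor R S).
Proof.
move=> x y; elim/quotient_ind: x => x; elim/quotient_ind: y => y.
rewrite /commute -!quotient_piM; apply/esym/piN_eqP; rewrite in_restrict.
have -> : (y * x)^-1 * (x * y) = [~ x, y] by rewrite /commg /conjg invgM !mulgA.
have -> : \val [~ x, y] = [~ \val x, \val y].
  by [].
by apply: RRS; apply: valP.
Qed.

Local Notation M := (additive_group abRS).

Let loop_in (c : Q) (w : F) : repr c * w * (repr (c * piR w))^-1 \in R.
Proof.
have E : piR (repr c * w) = piR (repr (c * piR w)).
  by rewrite quotient_piM !reprK.
have /esym/piN_eqP/(gpredJr _ (repr (c * piR w))^-1) := E.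
by rewrite /conjg invgK -mulgA mulVKg.
Qed.

(* The edge labelled [w] from the vertex [c] of the Cayley graph, closed up to a
   loop by the chosen representatives of its end points. *)
Let loop (c : Q) (w : F) : M :=
  \pi_(factor R S) (exist (fun x => x \in R) _ (loop_in c w)).

(** The representative of the intermediate vertex cancels. *)
Let loopM c w w' : loop c (w * w') = (loop c w + loop (c * piR w)%g w')%R.
Proof.
rewrite -[RHS]quotient_piM; congr (\pi_(factor R S) _); apply: val_inj => /=.
by rewrite quotient_piM !mulgA mulgVK.
Qed.

(** Reads [u.1 q] as the multiplicities of labelled edges leaving [q], translates these edges by [c]
    and adds up their loops. *)
Let flow (u : W) (c : Q) : M :=
  (\sum_(q <- finsupp u.1) zlift (loop (c * q)%g) (u.1 q))%R.

Let floww (d : {fset Q}) (u : W) c : (finsupp u.1 `<=` d)%fset ->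
  flow u c = (\sum_(q <- d) zlift (loop (c * q)%g) (u.1 q))%R.
Proof.
move=> le_d; rewrite /flow (big_fset_incl _ le_d) //= => q _.
by rewrite memNfinsupp => /eqP ->; exact: (zlift0 (loop (c * q))).
Qed.

Let flowM u v c : flow (u * v) c = (flow u c + flow v (c * u.2)%g)%R.
Proof.
(* A common support for all three sums; the sum for [v] is reindexed by translation with [u.2]. *)
pose d := (finsupp (u * v).1 `|` (finsupp u.1 `|` [fset u.2 * x | x in finsupp
  v.1]))%fset.
have d_v : (finsupp v.1 `<=` [fset u.2^-1 * x | x in d])%fset.
  apply/fsubsetP => q qv; apply/imfsetP; exists (u.2 * q); rewrite ?mulKg //=.
  by rewrite !in_fsetU (in_imfset _ _ qv) !orbT.
have d_u : (finsupp u.1 `<=` d)%fset by rewrite fsubsetU // fsubsetUl orbT.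
have d_uv : (finsupp (u * v).1 `<=` d)%fset by rewrite fsubsetUl.
clearbody d; rewrite (floww _ d_uv) (floww _ d_u) (floww _ d_v).
rewrite [X in (_ + X)%R]big_imfset /=; last by move=> x y _ _; apply: mulgI.
rewrite -big_split /=; apply: eq_bigr => q _.
by rewrite base_mulE translateE -mulgA mulVKg; apply: (zliftD (loop (c * q))).
Qed.

(* The free abelian group is taken on [F] and not on the index type [X] of the
   basis, which need not be a [choiceType]. *)
Let gen (x : F) : W :=
  ([fsfun q in [fset (1 : Q)]%fset => (<< x >>%R : A)], piR x).

Let flow_gen x c : flow (gen x) c = loop c x.
Proof.
rewrite (floww (d := [fset 1]%fset)).
  by rewrite big_seq_fset1 fsfun_fun in_fset1 eqxx mulg1 zliftU mulr1z.
by apply/fsubsetP => q; rewrite mem_finsupp fsfun_fun; case: ifP; rewrite ?eqxx.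
Qed.

(** By [RRS] and [Smin], [S] is the commutator subgroup of [R]. Since [flow] after [mu] and [loop]
    obey the same product rule and agree on the basis, [mu w] determines [loop 1 w]. *)
Lemma magnus_embedding : exists mu : {multiplicative F -> wreath A Q},
  forall w, mu w = 1 <-> w \in S.
Proof.
have [mu mub _] := freeF (fun i => gen (b i)); exists mu.
have flow1 c : flow 1 c = 0%R.
  apply: (addrI (flow 1 c)); rewrite addr0.
  by rewrite -[in RHS](mul1g 1) flowM mulg1.
have loop1 c : loop c 1 = 0%R.
  apply: (addrI (loop c 1)); rewrite addr0.
  by rewrite -[in RHS](mul1g 1) loopM mulg1.
have mu_flow w : (mu w).2 = piR w /\ forall c, flow (mu w) c = loop c w.
  apply: (free_basis_ind (P := fun w => (mu w).2 = piR w /\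
    forall c, flow (mu w) c = loop c w) freeF); first last.
  - by move=> i; rewrite mub; split=> // c; rewrite flow_gen.
  - move=> x [x2 xf]; have xV2 : (mu x^-1).2 = piR x^-1.
      by rewrite gmorphV /= x2; apply: quotient_invE.
    split=> // c; apply: (addIr (flow (mu x) (c * piR x^-1))).
    by rewrite -xV2 -flowM -gmulfM mulVg xf xV2 -loopM mulVg gmorph1 flow1
      loop1.
  - move=> x y [x2 xf] [y2 yf]; rewrite gmulfM; split=> [|c].
      by rewrite quotient_piM -x2 -y2.
    by rewrite flowM loopM xf yf x2.
  - by rewrite gmorph1; split=> // c; rewrite flow1 loop1.
move=> w; have [w2 wf] := mu_flow w; split=> [w1|].
  have := wf 1; rewrite w1 flow1 => /esym/esym/piN_eqP.
  (* The representative of the trivial coset need not be [1], so this yields only a conjugate of [w]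
     in [S]. *)
  rewrite invg1 mul1g in_restrict /=.
  have -> : piR w = 1 by rewrite -w2 w1.
  move=> /(gpredJr _ (repr (1 : Q))).
  by rewrite /conjg mulg1 mulgVK mulKg.
suff : {subset S <= gpreim mu (@trivial_subgroup W)}.
  by move=> sub /sub; rewrite in_gpreim => /eqP.
(* [mu] sends [R] into the abelian base group, so commutators of elements of [R] die. *)
apply: Smin => x y xR yR; rewrite in_gpreim in_trivial_subgroup.
have mu2 z : z \in R -> (mu z).2 = 1.
  by move=> zR; rewrite (mu_flow z).1; apply/esym/piN_eqP; rewrite invg1 mul1g.
rewrite /commg !(gmulfM, gmorphJ, gmorphV) -commgEl.
apply/commgP/wreath_eq => [q|] /=; last by rewrite !mu2.
by rewrite !base_mulE !translateE !mu2 // invg1 mul1g;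
  apply: free_abelian_abelian.
Qed.

Lemma magnus_rigid : rigid (quotient_group R) -> rigid (quotient_group S).
Proof.
move=> rigQ; have [mu muS] := magnus_embedding.
have rigW := wreath_rigid (@free_abelian_abelian F)
  (@free_abelian_torsion_free F) rigQ.
have trivE x : (x \in S) = (mu x \in @trivial_subgroup W).
  by apply/idP/eqP => /muS.
pose f (a : quotient_group S) : W := mu (repr a).
have fE x : f (\pi_(quotient_group S) x) = mu x.
  rewrite /f; have [u /muS mu1 ->] := repr_piN S x.
  by rewrite gmulfM mu1 mulg1.
have fM : {morph f : x y / x * y}.
  move=> x y; elim/quotient_ind: x => x; elim/quotient_ind: y => y.
  by rewrite -quotient_piM !fE gmulfM.
pose fmult := monoid.isMultiplicative.Build _ _ f fM.
pose f' : {multiplicative quotient_group S -> W} :=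
  HB.pack_for {multiplicative quotient_group S -> W} f fmult.
apply: (rigid_embedding (f := f')) rigW => x.
elim/quotient_ind: x => x; rewrite [f' _]fE => /muS xS.
by apply/esym/piN_eqP; rewrite invg1 mul1g.
Qed.

End Magnus.

Lemma free_solvable_rigid (F : groupType) (n : nat) :
  free_group F -> rigid (quotient_group (derived F n)).
Proof.
case=> X [b freeF]; elim: n => [|n IHn].
  (* The quotient by [derived F 0] is trivial and has a series of length 0. *)
  pose triv : normalClosed (quotient_group (derived F 0)) :=
    @trivial_subgroup (quotient_group (derived F 0)).
  have all1 (x : quotient_group (derived F 0)) : x = 1.
    by elim/quotient_ind: x => x; apply/esym/piN_eqP.
  exists 0%N, (fun=> triv); split=> [x|x _|i]; last by case: i.
    by rewrite in_trivial_subgroup (all1 x).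
  exact: all1.
(* The subgroup generated by the commutators lies in every subgroup containing them, in particular
   in every normal one. *)
apply: (magnus_rigid freeF) IHn => [x y xR yR|H RH].
  by apply/generatedP => H; apply; exists x, y.
by move=> x /generatedP; apply=> _ [u [v [uR vR ->]]]; apply: RH.
Qed.

Theorem proposition5p7 :
  (forall (F : groupType) (n : nat),
      free_group F -> rigid (quotient_group (derived F n)))
  /\
  (forall A B : groupType,
      abelian_group A -> torsion_free A -> rigid B -> rigid (wreath A B)).
Proof. by split; [exact: free_solvable_rigid | exact: wreath_rigid]. Qed.
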